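(* Let the collision term be $\mathcal C(f)=-\phi_0f+\phi_0\frac12\int_{-1}^1f\,d\mu+3\mu\phi_1\frac12\int_{-1}^1f\mu\,d\mu$, with $\tilde\chi\ne0$, $\tilde\chi+\phi_0\ne0$ and $\tilde\chi+\phi_0-\phi_1\neq0$. Assume Enskog's postulate and the strong Chapman--Enskog hypothesis $$\frac12\int_{-1}^1f_0\,d\mu=\beta,\qquad\frac12\int_{-1}^1f_i\,d\mu=0,\quad i=1,2,\dots$$ for the Chapman--Enskog expansion $f=\sum_{i\ge0}\varepsilon^if_i$ with $\beta=\frac12\int_{-1}^1f\,d\mu$. Then the diffusion-reaction-type equation $$\frac{d\beta}{c\,dt}+\frac13\frac{d\ln\rho}{c\,dt}\,\omega\frac{\partial\beta}{\partial\omega}-\frac1{r^2}\frac{\partial}{\partial r}\Big(r^2\frac\lambda3\frac{\partial\beta}{\partial r}\Big)=j-\tilde\chi\beta$$ is an approximation of the angular mean of Boltzmann's equation $\mathcal D(f)=\varepsilon^{-1}\big(\bar j+\bar{\mathcal J}(f)\big)$ of order $\mathcal O(\varepsilon^2)$ up to $\mathcal D^+\big(\mathcal D^+(\cdot)\big)$ terms.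
   Context: Variables: time $t$, radius $r>0$, cosine of the propagation angle $\mu\in[-1,1]$, energy $\omega>0$; $f=f(t,r,\mu,\omega)$. The constant $c>0$ is the speed of light; $\rho=\rho(t,r)>0$ and $v=v(t,r)$ are given functions (density and radial velocity of the background matter), and $\frac{d}{dt}:=\frac{\partial}{\partial t}+v\frac{\partial}{\partial r}$. The linear operator $\mathcal D=\mathcal D^++\mathcal D^-$ is given by $$\mathcal D^+(f)=\frac{df}{c\,dt}+\mu\Big(\frac{d\ln\rho}{c\,dt}+\frac{3v}{cr}\Big)(1-\mu^2)\frac{\partial f}{\partial\mu}+\Big[\mu^2\Big(\frac{d\ln\rho}{c\,dt}+\frac{3v}{cr}\Big)-\frac v{cr}\Big]\omega\frac{\partial f}{\partial\omega},$$ $$\mathcal D^-(f)=\mu\frac{\partial f}{\partial r}+\frac1r(1-\mu^2)\frac{\partial f}{\partial\mu}.$$ Write $F_\mu$ and $F_\omega$ for the total coefficients of $\frac{\partial f}{\partial\mu}$ and $\frac{\partial f}{\partial\omega}$ in $\mathcal D$. The functions $j\ge0$ (emissivity), $\chi\geq 0$ (absorptivity), $\tilde\chi=j+\chi$, $\phi_0,\phi_1$ depend on $(t,r,\omega)$ but not on $\mu$. Put $\mathcal J(f)=-\tilde\chi f+\mathcal C(f)$ and $\lambda=\frac1{\tilde\chi+\phi_0-\phi_1}$. Here $\varepsilon>0$ is a small parameter, $\bar j=\varepsilon j$, $\bar{\tilde\chi}=\varepsilon\tilde\chi$, $\bar\phi_0=\varepsilon\phi_0$, $\bar\phi_1=\varepsilon\phi_1$,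 $\bar{\mathcal J}=\varepsilon\mathcal J$, and the barred quantities are independent of $\varepsilon$ (so $j,\tilde\chi$ are of order $\varepsilon^{-1}$ and $\lambda$ is of order $\varepsilon$). Chapman--Enskog expansion: $f=\sum_{i\ge0}\varepsilon^i f_i$, $\beta=\sum_{i\ge0}\varepsilon^i\beta_i$, $\beta_i=\frac12\int_{-1}^1 f_i\,d\mu$. Enskog's postulate: $f=f\big(r,\mu,\omega\,|\,\beta,\frac{\partial\beta}{\partial r},\frac{\partial^2\beta}{\partial r^2},\dots\big)$, and likewise all $f_i$, depend on time only via $\beta$ and its spatial derivatives, which are treated as independent variables. With $\frac{\partial_i}{\partial t}:=\sum_{k=0}^\infty\frac{\partial^k}{\partial r^k}\frac{\partial\beta_i}{\partial t}\cdot\frac{\partial}{\partial\frac{\partial^k\beta}{\partial r^k}}$ one has formally $\mathcal D(f)=\sum_{i\ge0}\varepsilon^i\mathcal D(f)^{(i)}$, $$\mathcal D(f)^{(i)}=\sum_{l=0}^i\frac{\partial_{i-l}f_l}{c\,\partial t}+v\frac{\partial f_i}{c\,\partial r}+\mu\frac{\partial f_i}{\partial r}+F_\mu\frac{\partial f_i}{\partial\mu}+F_\omega\frac{\partial f_i}{\partial\omega},$$ and the $f_i$ solve the hierarchy $0=j+\mathcal J(f_0)$, $\mathcal D(f)^{(i-1)}=\bar{\mathcal J}(f_i)$, $i=1,2,\dots$. Meaning of the conclusion: the angular mean of Boltzmann's equation is $\frac12\int_{-1}^1\mathcal D(f)\,d\mu=j-\tilde\chi\beta$. The conclusion states that its left-hand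 side equals the left-hand side of the displayed equation, plus $N$, plus $\mathcal O(\varepsilon^2)$, where $N$ is the sum of the neglected $\mathcal D^+(\mathcal D^+(\cdot))$ terms, $$N=\frac12\int_{-1}^1\mathcal D^+\Big(\frac{-1}{\tilde\chi+\phi_0}\Big[\mathcal D^+(f_0)+\frac{\phi_0}{\tilde\chi}\frac12\int_{-1}^1\mathcal D^+(f_0)\,d\mu+3\mu\phi_1\lambda\frac12\int_{-1}^1\mathcal D^+(f_0)\mu\,d\mu\Big]\Big)d\mu .$$ All series are formal; series, integrals and partial derivatives are assumed to be interchangeable; $\mathcal O(\varepsilon^k)$ denotes, in the formal sense, the neglected part starting with order $\varepsilon^k$ of a formal series in $\varepsilon$. *)

(* Defs.v *)
From Stdlib Require Import Reals.
From Coquelicot Require Import Coquelicot.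

Local Open Scope R_scope.

(* Partial derivatives of functions of (t, r, omega).  A function of
   (t, r, mu, omega) is differentiated in t, r, omega at frozen mu. *)
Definition d_t (g : R -> R -> R -> R) (t r w : R) : R :=
  Derive (fun s => g s r w) t.
Definition d_r (g : R -> R -> R -> R) (t r w : R) : R :=
  Derive (fun x => g t x w) r.
Definition d_w (g : R -> R -> R -> R) (t r w : R) : R :=
  Derive (fun y => g t r y) w.
Definition d_mu (f : R -> R -> R -> R -> R) (t r mu w : R) : R :=
  Derive (fun m => f t r m w) mu.

Definition freeze (f : R -> R -> R -> R -> R) (mu : R) : R -> R -> R -> R :=
  fun t r w => f t r mu w.

(* Class C^n on the open set { r > 0, omega > 0 }. *)
Fixpoint class_C (n : nat) (g : R -> R -> R -> R) : Prop :=
  (forall t r w, 0 < r -> 0 < w ->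
     continuous (fun p : R * R * R => g (fst (fst p)) (snd (fst p)) (snd p))
                (t, r, w)) /\
  match n with
  | O => True
  | S m =>
      (forall t r w, 0 < r -> 0 < w ->
         ex_derive (fun s => g s r w) t /\
         ex_derive (fun x => g t x w) r /\
         ex_derive (fun y => g t r y) w) /\
      class_C m (d_t g) /\ class_C m (d_r g) /\ class_C m (d_w g)
  end.

Definition smooth (g : R -> R -> R -> R) : Prop := forall n, class_C n g.

Definition mean (f : R -> R -> R -> R -> R) (t r w : R) : R :=
  / 2 * RInt (fun mu => f t r mu w) (-1) 1.

Definition mean_mu (f : R -> R -> R -> R -> R) : R -> R -> R -> R :=
  mean (fun t r mu w => f t r mu w * mu).

Record background := Background {
  light : R;
  rho : R -> R -> R;
  vel : R -> R -> R }.

Record background_ok (B : background) : Prop := {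
  light_pos : 0 < light B;
  rho_pos : forall t r, 0 < r -> 0 < rho B t r;
  rho_smooth : smooth (fun t r _ => rho B t r);
  vel_smooth : smooth (fun t r _ => vel B t r) }.

Definition dlnrho_dt (B : background) (t r : R) : R :=
  Derive (fun s => ln (rho B s r)) t
  + vel B t r * Derive (fun x => ln (rho B t x)) r.

Definition compression (B : background) (t r : R) : R :=
  dlnrho_dt B t r / light B + 3 * vel B t r / (light B * r).

Definition F_mu_plus (B : background) (t r mu : R) : R :=
  mu * compression B t r * (1 - mu ^ 2).
Definition F_mu_minus (r mu : R) : R := / r * (1 - mu ^ 2).
Definition F_mu (B : background) (t r mu : R) : R :=
  F_mu_plus B t r mu + F_mu_minus r mu.
Definition F_w (B : background) (t r mu w : R) : R :=
  (mu ^ 2 * compression B t r - vel B t r / (light B * r)) * w.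

Definition D_plus (B : background) (f : R -> R -> R -> R -> R)
    (t r mu w : R) : R :=
  (d_t (freeze f mu) t r w + vel B t r * d_r (freeze f mu) t r w) / light B
  + F_mu_plus B t r mu * d_mu f t r mu w
  + F_w B t r mu w * d_w (freeze f mu) t r w.

Record medium := Medium {
  emis : R -> R -> R -> R;
  absorp : R -> R -> R -> R;
  phi0 : R -> R -> R -> R;
  phi1 : R -> R -> R -> R }.

Definition chit (M : medium) (t r w : R) : R := emis M t r w + absorp M t r w.

Definition lambda (M : medium) (t r w : R) : R :=
  1 / (chit M t r w + phi0 M t r w - phi1 M t r w).

Record medium_ok (M : medium) : Prop := {
  emis_smooth : smooth (emis M);
  absorp_smooth : smooth (absorp M);
  phi0_smooth : smooth (phi0 M);
  phi1_smooth : smooth (phi1 M);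
  emis_ge0 : forall t r w, 0 < r -> 0 < w -> 0 <= emis M t r w;
  absorp_ge0 : forall t r w, 0 < r -> 0 < w -> 0 <= absorp M t r w;
  chit_neq0 : forall t r w, 0 < r -> 0 < w -> chit M t r w <> 0;
  chit_phi0_neq0 : forall t r w, 0 < r -> 0 < w ->
    chit M t r w + phi0 M t r w <> 0;
  chit_phi0_phi1_neq0 : forall t r w, 0 < r -> 0 < w ->
    chit M t r w + phi0 M t r w - phi1 M t r w <> 0 }.

(* [Mbar] carries the eps-independent barred coefficients; [unbar eps Mbar] the
   coefficients themselves, j = jbar / eps and so on. *)
Definition unbar (eps : R) (Mbar : medium) : medium :=
  Medium (fun t r w => emis Mbar t r w / eps)
         (fun t r w => absorp Mbar t r w / eps)
         (fun t r w => phi0 Mbar t r w / eps)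
         (fun t r w => phi1 Mbar t r w / eps).

Definition collision (M : medium) (f : R -> R -> R -> R -> R)
    (t r mu w : R) : R :=
  - phi0 M t r w * f t r mu w + phi0 M t r w * mean f t r w
  + 3 * mu * phi1 M t r w * mean_mu f t r w.

(* The operator calJ; calJ of [Mbar] is eps times calJ of [unbar eps Mbar]. *)
Definition calJ (M : medium) (f : R -> R -> R -> R -> R) (t r mu w : R) : R :=
  - chit M t r w * f t r mu w + collision M f t r mu w.

(* The spatial jet (beta, d beta/dr, d^2 beta/dr^2, ...) at (t, r, omega). *)
Definition jet (beta : R -> R -> R -> R) (t r w : R) : nat -> R :=
  fun k => Derive_n (fun x => beta t x w) k r.

Definition set_coord (b : nat -> R) (k : nat) (y : R) : nat -> R :=
  fun n => if Nat.eqb n k then y else b n.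

Definition jet_partial (G : (nat -> R) -> R) (k : nat) (b : nat -> R) : R :=
  Derive (fun y => G (set_coord b k y)) (b k).

(* A coefficient of the expansion is a function F l of r, mu, omega and of the
   independent jet variables, without explicit time; [along] evaluates it on
   the jet of an actual field beta. *)
Definition along (F : nat -> R -> R -> R -> (nat -> R) -> R)
    (beta : R -> R -> R -> R) (l : nat) : R -> R -> R -> R -> R :=
  fun t r mu w => F l r mu w (jet beta t r w).

(* Time enters f_l only through the jet of beta, and may be differentiated
   there term by term.  This is the chain rule when F l is C^1 in finitely many
   jet variables; for infinitely many it is the interchange of series and
   derivatives presupposed by the formal calculus. *)
Definition enskog_postulate (F : nat -> R -> R -> R -> (nat -> R) -> R)
    (beta : R -> R -> R -> R) : Prop :=
  forall l t r mu w, 0 < r -> -1 <= mu <= 1 -> 0 < w ->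
    (forall k, ex_derive
       (fun y => F l r mu w (set_coord (jet beta t r w) k y))
       (jet beta t r w k)) /\
    ex_derive (fun s => along F beta l s r mu w) t /\
    is_series
      (fun k => Derive (fun s => jet beta s r w k) t
                * jet_partial (F l r mu w) k (jet beta t r w))
      (Derive (fun s => along F beta l s r mu w) t).

(* d_i f_l / dt, with beta_i the angular mean of f_i. *)
Definition d_t_order (F : nat -> R -> R -> R -> (nat -> R) -> R)
    (beta : R -> R -> R -> R) (i l : nat) (t r mu w : R) : R :=
  Series (fun k =>
    Derive_n (fun x => d_t (mean (along F beta i)) t x w) k r
    * jet_partial (F l r mu w) k (jet beta t r w)).

(* The coefficient of eps^i in the formal series D(f), f = sum_i eps^i f_i. *)
Definition D_order (B : background)
    (F : nat -> R -> R -> R -> (nat -> R) -> R) (beta : R -> R -> R -> R)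
    (i : nat) (t r mu w : R) : R :=
  let f := along F beta in
  sum_f_R0 (fun l => d_t_order F beta (i - l) l t r mu w / light B) i
  + vel B t r * d_r (freeze (f i) mu) t r w / light B
  + mu * d_r (freeze (f i) mu) t r w
  + F_mu B t r mu * d_mu (f i) t r mu w
  + F_w B t r mu w * d_w (freeze (f i) mu) t r w.

(* The equations are imposed along the field beta, not identically in the jet
   variables: averaging the first one gives jbar = chitbar * beta under the
   strong Chapman-Enskog hypothesis, which no identity in free jet variables
   could satisfy. *)
Definition hierarchy (B : background) (Mbar : medium)
    (F : nat -> R -> R -> R -> (nat -> R) -> R)
    (beta : R -> R -> R -> R) : Prop :=
  forall t r mu w, 0 < r -> -1 <= mu <= 1 -> 0 < w ->
    0 = emis Mbar t r w + calJ Mbar (along F beta 0) t r mu w /\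
    forall i, (1 <= i)%nat ->
      D_order B F beta (i - 1) t r mu w = calJ Mbar (along F beta i) t r mu w.

Definition strong_chapman_enskog (F : nat -> R -> R -> R -> (nat -> R) -> R)
    (beta : R -> R -> R -> R) : Prop :=
  forall t r w, 0 < r -> 0 < w ->
    mean (along F beta 0) t r w = beta t r w /\
    forall i, (1 <= i)%nat -> mean (along F beta i) t r w = 0.

Definition diffusion_lhs (B : background) (M : medium)
    (beta : R -> R -> R -> R) (t r w : R) : R :=
  (d_t beta t r w + vel B t r * d_r beta t r w) / light B
  + / 3 * (dlnrho_dt B t r / light B) * w * d_w beta t r w
  - / r ^ 2
    * Derive (fun x => x ^ 2 * (lambda M t x w / 3) * d_r beta t x w) r.

Definition neglected (B : background) (M : medium)
    (f0 : R -> R -> R -> R -> R) (t r w : R) : R :=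
  mean (D_plus B (fun t r mu w =>
    - 1 / (chit M t r w + phi0 M t r w)
    * (D_plus B f0 t r mu w
       + phi0 M t r w / chit M t r w * mean (D_plus B f0) t r w
       + 3 * mu * phi1 M t r w * lambda M t r w
         * mean_mu (D_plus B f0) t r w))) t r w.

(* A formal series in eps is its sequence of coefficients; a function of eps
   that is polynomial is identified with its finite expansion. *)
Definition has_expansion (G : R -> R) (g : nat -> R) : Prop :=
  exists n, (forall i, (n < i)%nat -> g i = 0) /\
    forall eps, 0 < eps -> G eps = sum_f_R0 (fun i => g i * eps ^ i) n.

Definition O_eps (k : nat) (s : nat -> R) : Prop :=
  forall i, (i < k)%nat -> s i = 0.

(* Main.v *)
(* Averaging the zeroth equation of the hierarchy and its first moment in mu
   forces f_0 = beta, hence D(f)^(0) = D(beta) = a + mu d_r beta + mu^2 e with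
   zero mean a + e/3.  Solving the first-order equation, with
   S = chitilde + phi_0, then gives
     f_1 = - a/S - mu lambda d_r beta - mu^2 e/S.
   D^+ preserves and D^- reverses parity in mu, so in the mean of D(f_1) the
   odd part contributes only through D^-, which is the diffusion term, and the
   even part -D^+(beta)/S only through D^+, which is the neglected term. *)
Require Import Defs.
From Stdlib Require Import Reals Lra Lia.
From Coquelicot Require Import Coquelicot.

Local Open Scope R_scope.

(** * Comparison on the open domain and angular means of polynomials *)

Lemma locally_pos (x : R) : 0 < x -> locally x (fun y => 0 < y).
Proof. exact (open_gt 0 x). Qed.

Lemma locally_between (a b x : R) :
  a < x < b -> locally x (fun y => a < y < b).
Proof.
  intros [Ha Hb]; apply filter_and; [exact (open_gt a x Ha) | exact (open_lt b x Hb)].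
Qed.

(** The hypotheses speak only about r > 0 and omega > 0. This set is open in each variable, so
    equality on it passes to all partial derivatives. *)
Definition eq3 (g h : R -> R -> R -> R) : Prop :=
  forall t r w, 0 < r -> 0 < w -> g t r w = h t r w.

Definition eq4 (f g : R -> R -> R -> R -> R) : Prop :=
  forall t r mu w, 0 < r -> -1 < mu < 1 -> 0 < w -> f t r mu w = g t r mu w.

Lemma d_t_eq3 (g h : R -> R -> R -> R) : eq3 g h -> eq3 (d_t g) (d_t h).
Proof.
  intros H t r w Hr Hw; apply Derive_ext; intros s; now apply H.
Qed.

Lemma d_r_eq3 (g h : R -> R -> R -> R) : eq3 g h -> eq3 (d_r g) (d_r h).
Proof.
  intros H t r w Hr Hw; apply Derive_ext_loc.
  generalize (locally_pos r Hr); apply filter_imp; intros x Hx; now apply H.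
Qed.

Lemma d_w_eq3 (g h : R -> R -> R -> R) : eq3 g h -> eq3 (d_w g) (d_w h).
Proof.
  intros H t r w Hr Hw; apply Derive_ext_loc.
  generalize (locally_pos w Hw); apply filter_imp; intros y Hy; now apply H.
Qed.

Lemma freeze_eq4 (f g : R -> R -> R -> R -> R) (mu : R) :
  eq4 f g -> -1 < mu < 1 -> eq3 (freeze f mu) (freeze g mu).
Proof. intros H Hmu t r w Hr Hw; now apply H. Qed.

Lemma d_mu_eq4 (f g : R -> R -> R -> R -> R) :
  eq4 f g -> eq4 (d_mu f) (d_mu g).
Proof.
  intros H t r mu w Hr Hmu Hw; apply Derive_ext_loc.
  generalize (locally_between _ _ _ Hmu); apply filter_imp; intros m Hm; now apply H.
Qed.

Lemma mean_eq4 (f g : R -> R -> R -> R -> R) :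
  eq4 f g -> eq3 (mean f) (mean g).
Proof.
  intros H t r w Hr Hw; unfold mean; f_equal; apply RInt_ext.
  rewrite Rmin_left, Rmax_right by lra; intros mu Hmu; now apply H.
Qed.

Definition D_minus (f : R -> R -> R -> R -> R) (t r mu w : R) : R :=
  mu * d_r (freeze f mu) t r w + F_mu_minus r mu * d_mu f t r mu w.

Lemma D_plus_eq4 (B : background) (f g : R -> R -> R -> R -> R) :
  eq4 f g -> eq4 (D_plus B f) (D_plus B g).
Proof.
  intros H t r mu w Hr Hmu Hw.
  pose proof (freeze_eq4 f g mu H Hmu) as Hmu'.
  unfold D_plus.
  now rewrite (d_t_eq3 _ _ Hmu'), (d_r_eq3 _ _ Hmu'), (d_w_eq3 _ _ Hmu'),
    (d_mu_eq4 _ _ H).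
Qed.

Lemma D_minus_eq4 (f g : R -> R -> R -> R -> R) :
  eq4 f g -> eq4 (D_minus f) (D_minus g).
Proof.
  intros H t r mu w Hr Hmu Hw.
  pose proof (freeze_eq4 f g mu H Hmu) as Hmu'.
  unfold D_minus; now rewrite (d_r_eq3 _ _ Hmu'), (d_mu_eq4 _ _ H).
Qed.

(** Degree four suffices throughout: the coefficients of D^+ raise the degree of a quadratic
    polynomial in mu by at most two, those of D^- by at most one. Odd powers integrate to zero. *)
Lemma mean_quartic (f : R -> R -> R -> R -> R) (t r w a0 a1 a2 a3 a4 : R) :
  (forall mu, -1 < mu < 1 ->
     f t r mu w = a0 + a1 * mu + a2 * mu ^ 2 + a3 * mu ^ 3 + a4 * mu ^ 4) ->
  mean f t r w = a0 + a2 / 3 + a4 / 5.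
Proof.
  intros H; unfold mean.
  rewrite (RInt_ext _
    (fun mu => a0 + a1 * mu + a2 * mu ^ 2 + a3 * mu ^ 3 + a4 * mu ^ 4)).
  2:{ rewrite Rmin_left, Rmax_right by lra; exact H. }
  set (P := fun mu => a0 * mu + a1 * mu ^ 2 / 2 + a2 * mu ^ 3 / 3
                      + a3 * mu ^ 4 / 4 + a4 * mu ^ 5 / 5).
  rewrite (is_RInt_unique _ _ _ (minus (P 1) (P (-1)))).
  - unfold P, minus, plus, opp; simpl; field.
  - apply (is_RInt_derive P); intros x _.
    + unfold P; auto_derive; [easy | simpl; field].
    + apply (ex_derive_continuous (V := R_NormedModule)); auto_derive; easy.
Qed.

(** * Partial differentiability and its closure rules *)

Definition partially_derivable (g : R -> R -> R -> R) : Prop :=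
  forall t r w, 0 < r -> 0 < w ->
    ex_derive (fun s => g s r w) t /\
    ex_derive (fun x => g t x w) r /\
    ex_derive (fun y => g t r y) w.

Lemma partially_derivable_eq3 (g h : R -> R -> R -> R) :
  eq3 g h -> partially_derivable g -> partially_derivable h.
Proof.
  intros H Hg t r w Hr Hw; destruct (Hg t r w Hr Hw) as (Ht & Hx & Hy).
  repeat split.
  - refine (ex_derive_ext _ _ _ _ Ht); intros s; now apply H.
  - refine (ex_derive_ext_loc _ _ _ _ Hx).
    generalize (locally_pos r Hr); apply filter_imp; intros x Hx'; now apply H.
  - refine (ex_derive_ext_loc _ _ _ _ Hy).
    generalize (locally_pos w Hw); apply filter_imp; intros y Hy'; now apply H.
Qed.

Lemma partially_derivable_const (k : R) :
  partially_derivable (fun _ _ _ => k).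
Proof. repeat split; apply ex_derive_const. Qed.

Lemma partially_derivable_r : partially_derivable (fun _ r _ => r).
Proof. intros t r w _ _; repeat split; auto_derive; easy. Qed.

Lemma partially_derivable_w : partially_derivable (fun _ _ w => w).
Proof. intros t r w _ _; repeat split; auto_derive; easy. Qed.

Lemma partially_derivable_plus (g h : R -> R -> R -> R) :
  partially_derivable g -> partially_derivable h ->
  partially_derivable (fun t r w => g t r w + h t r w).
Proof.
  intros Hg Hh t r w Hr Hw.
  destruct (Hg t r w Hr Hw) as (? & ? & ?), (Hh t r w Hr Hw) as (? & ? & ?).
  repeat split; now apply (ex_derive_plus (V := R_NormedModule)).
Qed.

Lemma partially_derivable_mult (g h : R -> R -> R -> R) :
  partially_derivable g -> partially_derivable h ->
  partially_derivable (fun t r w => g t r w * h t r w).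
Proof.
  intros Hg Hh t r w Hr Hw.
  destruct (Hg t r w Hr Hw) as (? & ? & ?), (Hh t r w Hr Hw) as (? & ? & ?).
  repeat split; now apply ex_derive_mult.
Qed.

Lemma partially_derivable_opp (g : R -> R -> R -> R) :
  partially_derivable g -> partially_derivable (fun t r w => - g t r w).
Proof.
  intros Hg t r w Hr Hw; destruct (Hg t r w Hr Hw) as (? & ? & ?).
  repeat split; now apply (ex_derive_opp (V := R_NormedModule)).
Qed.

Lemma partially_derivable_div (g h : R -> R -> R -> R) :
  (forall t r w, 0 < r -> 0 < w -> h t r w <> 0) ->
  partially_derivable g -> partially_derivable h ->
  partially_derivable (fun t r w => g t r w / h t r w).
Proof.
  intros H0 Hg Hh t r w Hr Hw.
  destruct (Hg t r w Hr Hw) as (? & ? & ?), (Hh t r w Hr Hw) as (? & ? & ?).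
  pose proof (H0 t r w Hr Hw).
  repeat split; now apply ex_derive_div.
Qed.

(** * Smooth fields and interchange of time and radial derivatives *)

Lemma smooth_partially_derivable (g : R -> R -> R -> R) :
  smooth g -> partially_derivable g.
Proof. intros H; exact (proj1 (proj2 (H 1%nat))). Qed.

Lemma smooth_d_t (g : R -> R -> R -> R) : smooth g -> smooth (d_t g).
Proof. intros H n; apply (H (S n)). Qed.

Lemma smooth_d_r (g : R -> R -> R -> R) : smooth g -> smooth (d_r g).
Proof. intros H n; apply (H (S n)). Qed.

Lemma smooth_d_w (g : R -> R -> R -> R) : smooth g -> smooth (d_w g).
Proof. intros H n; apply (H (S n)). Qed.

(** Supplies the continuity of the mixed derivatives in the form that [Schwarz] expects, by freezing
    omega in the joint continuity on triples. *)
Lemma smooth_continuity_2d (g : R -> R -> R -> R) (t r w : R) :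
  smooth g -> 0 < r -> 0 < w -> continuity_2d_pt (fun s x => g s x w) t r.
Proof.
  intros H Hr Hw; apply continuity_2d_pt_filterlim.
  apply (continuous_comp_2
    (U := prod_UniformSpace R_UniformSpace R_UniformSpace)
    (fun p : R * R => p) (fun _ : R * R => w) (fun p y => g (fst p) (snd p) y)
    (t, r)).
  - apply continuous_id.
  - apply continuous_const.
  - exact (proj1 (H O) t r w Hr Hw).
Qed.

Lemma d_t_d_r_comm (g : R -> R -> R -> R) :
  smooth g -> eq3 (d_t (d_r g)) (d_r (d_t g)).
Proof.
  intros H t r w Hr Hw.
  apply (Schwarz (fun s x => g s x w) t r).
  (* Radius [r] keeps the neighbourhood inside the half-line x > 0, where smoothness is known. *)
  - exists (mkposreal r Hr); simpl; intros s x _ Hx.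
    assert (Hx' : 0 < x) by (apply Rabs_def2 in Hx; lra).
    destruct (smooth_partially_derivable _ H s x w Hx' Hw) as (? & ? & _).
    destruct (smooth_partially_derivable _ (smooth_d_r _ H) s x w Hx' Hw)
      as (? & _).
    destruct (smooth_partially_derivable _ (smooth_d_t _ H) s x w Hx' Hw)
      as (_ & ? & _).
    repeat split; assumption.
  - exact (smooth_continuity_2d _ t r w (smooth_d_t _ (smooth_d_r _ H)) Hr Hw).
  - exact (smooth_continuity_2d _ t r w (smooth_d_r _ (smooth_d_t _ H)) Hr Hw).
Qed.

(** * Jets and the time derivatives in the formal series *)

Lemma Derive_n_eq3 (g h : R -> R -> R -> R) (k : nat) :
  eq3 g h ->
  eq3 (fun t r w => Derive_n (fun x => g t x w) k r)
      (fun t r w => Derive_n (fun x => h t x w) k r).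
Proof.
  intros H t r w Hr Hw; apply Derive_n_ext_loc.
  generalize (locally_pos r Hr); apply filter_imp; intros x Hx; now apply H.
Qed.

(** Reconciles two conventions: [d_t_order] takes radial derivatives of a time derivative, whereas
    [enskog_postulate] takes time derivatives of the jet coordinates. *)
Lemma jet_d_t (k : nat) (g : R -> R -> R -> R) (t r w : R) :
  smooth g -> 0 < r -> 0 < w ->
  jet (d_t g) t r w k = Derive (fun s => jet g s r w k) t.
Proof.
  intros H Hr Hw; revert g H; induction k as [|k IH]; intros g H.
  - reflexivity.
  (* The innermost radial derivative is peeled off, not the outermost as in the recursion of
     [Derive_n]; the induction hypothesis then applies to [d_r g], which is why [g] was
     generalized. *)
  - assert (E : forall g s, jet g s r w (S k) = jet (d_r g) s r w k).
    { intros h s; unfold jet; rewrite <- Nat.add_1_r.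
      symmetry; exact (Derive_n_comp (fun x => h s x w) k 1 r). }
    rewrite E, (Derive_ext _ _ t (E g)), <- (IH _ (smooth_d_r _ H)).
    symmetry; exact (Derive_n_eq3 _ _ k (d_t_d_r_comm g H) t r w Hr Hw).
Qed.

(** Since the mean of f_0 is beta, the series in [d_t_order] is term by term the chain-rule series
    of Enskog's postulate. *)
Lemma d_t_order_0 (F : nat -> R -> R -> R -> (nat -> R) -> R)
    (beta : R -> R -> R -> R) (l : nat) :
  smooth beta -> enskog_postulate F beta -> strong_chapman_enskog F beta ->
  eq4 (d_t_order F beta 0 l)
      (fun t r mu w => d_t (freeze (along F beta l) mu) t r w).
Proof.
  intros Hbeta Hpost Hstrong t r mu w Hr Hmu Hw.
  destruct (Hpost l t r mu w Hr ltac:(lra) Hw) as (_ & _ & Hser).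
  refine (eq_trans _ (is_series_unique _ _ Hser)).
  apply Series_ext; intros k; f_equal.
  rewrite <- jet_d_t by assumption.
  refine (Derive_n_eq3 _ _ k (d_t_eq3 _ _ _) t r w Hr Hw).
  intros s x y Hx Hy; now apply Hstrong.
Qed.

(** The mean of f_i vanishes for i >= 1, and with it every factor on the left of the terms of the
    series. *)
Lemma d_t_order_S (F : nat -> R -> R -> R -> (nat -> R) -> R)
    (beta : R -> R -> R -> R) (i l : nat) :
  strong_chapman_enskog F beta -> (1 <= i)%nat ->
  eq4 (d_t_order F beta i l) (fun _ _ _ _ => 0).
Proof.
  intros Hstrong Hi t r mu w Hr Hmu Hw.
  (* Writing 0 as 0 times a series reduces the claim to a termwise comparison of two series. *)
  rewrite <- (Rmult_0_l (Series (fun _ => 0))), <- Series_scal_l.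
  apply Series_ext; intros k; rewrite Rmult_0_l.
  assert (Hz : eq3 (d_t (mean (along F beta i))) (fun _ _ _ => 0)).
  { intros s x y Hx Hy.
    rewrite (d_t_eq3 _ (fun _ _ _ => 0)).
    - exact (Derive_const 0 s).
    - intros s' x' y' Hx' Hy'; now apply Hstrong.
    - assumption.
    - assumption. }
  rewrite (Derive_n_eq3 _ _ k Hz t r w Hr Hw).
  destruct k as [|k]; [simpl | rewrite Derive_n_const]; ring.
Qed.

(* The strong Chapman-Enskog hypothesis leaves only the term l = i of the
   convolution of time derivatives, so every order of D(f) is D applied to the
   corresponding coefficient. *)
Lemma D_order_along (B : background)
    (F : nat -> R -> R -> R -> (nat -> R) -> R) (beta : R -> R -> R -> R)
    (i : nat) :
  smooth beta -> enskog_postulate F beta -> strong_chapman_enskog F beta ->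
  eq4 (D_order B F beta i)
      (fun t r mu w => D_plus B (along F beta i) t r mu w
                       + D_minus (along F beta i) t r mu w).
Proof.
  intros Hbeta Hpost Hstrong t r mu w Hr Hmu Hw.
  assert (E : sum_f_R0
      (fun l => d_t_order F beta (i - l) l t r mu w / light B) i
      = d_t (freeze (along F beta i) mu) t r w / light B).
  { assert (E0 : d_t_order F beta (i - i) i t r mu w
                 = d_t (freeze (along F beta i) mu) t r w)
      by (rewrite Nat.sub_diag; now apply d_t_order_0).
    destruct i as [|i]; [simpl in *; now rewrite E0 |].
    (* The last summand is split off; in the remaining ones the order of the time derivative is at
       least one. *)
    rewrite tech5, E0, sum_eq_R0; [apply Rplus_0_l |].
    intros l Hl; rewrite d_t_order_S by (assumption || lia).
    apply Rmult_0_l. }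
  unfold D_order; rewrite E.
  unfold D_plus, D_minus, F_mu; unfold Rdiv; ring.
Qed.

(** * Means of D^+ and D^- on quadratic polynomials in mu *)

Definition quad (P0 P1 P2 : R -> R -> R -> R) (t r mu w : R) : R :=
  P0 t r w + mu * P1 t r w + mu ^ 2 * P2 t r w.

Lemma Derive_quad (p0 p1 p2 : R -> R) (mu x : R) :
  ex_derive p0 x -> ex_derive p1 x -> ex_derive p2 x ->
  Derive (fun y => p0 y + mu * p1 y + mu ^ 2 * p2 y) x
  = Derive p0 x + mu * Derive p1 x + mu ^ 2 * Derive p2 x.
Proof.
  intros H0 H1 H2; apply is_derive_unique.
  apply (is_derive_plus (fun y => p0 y + mu * p1 y) (fun y => mu ^ 2 * p2 y)).
  - apply (is_derive_plus p0 (fun y => mu * p1 y)).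
    + now apply Derive_correct.
    + now apply is_derive_scal, Derive_correct.
  - now apply is_derive_scal, Derive_correct.
Qed.

Lemma d_t_quad (P0 P1 P2 : R -> R -> R -> R) (t r mu w : R) :
  partially_derivable P0 -> partially_derivable P1 -> partially_derivable P2 ->
  0 < r -> 0 < w ->
  d_t (freeze (quad P0 P1 P2) mu) t r w = quad (d_t P0) (d_t P1) (d_t P2) t r mu w.
Proof.
  intros H0 H1 H2 Hr Hw; exact (Derive_quad _ _ _ _ _
    (proj1 (H0 t r w Hr Hw))
    (proj1 (H1 t r w Hr Hw))
    (proj1 (H2 t r w Hr Hw))).
Qed.

Lemma d_r_quad (P0 P1 P2 : R -> R -> R -> R) (t r mu w : R) :
  partially_derivable P0 -> partially_derivable P1 -> partially_derivable P2 ->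
  0 < r -> 0 < w ->
  d_r (freeze (quad P0 P1 P2) mu) t r w = quad (d_r P0) (d_r P1) (d_r P2) t r mu w.
Proof.
  intros H0 H1 H2 Hr Hw; exact (Derive_quad _ _ _ _ _
    (proj1 (proj2 (H0 t r w Hr Hw)))
    (proj1 (proj2 (H1 t r w Hr Hw)))
    (proj1 (proj2 (H2 t r w Hr Hw)))).
Qed.

Lemma d_w_quad (P0 P1 P2 : R -> R -> R -> R) (t r mu w : R) :
  partially_derivable P0 -> partially_derivable P1 -> partially_derivable P2 ->
  0 < r -> 0 < w ->
  d_w (freeze (quad P0 P1 P2) mu) t r w = quad (d_w P0) (d_w P1) (d_w P2) t r mu w.
Proof.
  intros H0 H1 H2 Hr Hw; exact (Derive_quad _ _ _ _ _
    (proj2 (proj2 (H0 t r w Hr Hw)))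
    (proj2 (proj2 (H1 t r w Hr Hw)))
    (proj2 (proj2 (H2 t r w Hr Hw)))).
Qed.

Lemma d_mu_quad (P0 P1 P2 : R -> R -> R -> R) (t r mu w : R) :
  d_mu (quad P0 P1 P2) t r mu w = P1 t r w + 2 * mu * P2 t r w.
Proof.
  apply is_derive_unique; unfold quad; auto_derive; [easy | ring].
Qed.

(* [D_plus] preserves parity in mu, so [P1] does not contribute. *)
Lemma mean_D_plus_quad (B : background) (P0 P1 P2 : R -> R -> R -> R)
    (t r w : R) :
  partially_derivable P0 -> partially_derivable P1 -> partially_derivable P2 ->
  0 < r -> 0 < w ->
  mean (D_plus B (quad P0 P1 P2)) t r w =
  (d_t P0 t r w + vel B t r * d_r P0 t r w) / light B
  + (d_t P2 t r w + vel B t r * d_r P2 t r w) / light B / 3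
  + (compression B t r / 3 - vel B t r / (light B * r)) * w * d_w P0 t r w
  + (compression B t r / 5 - vel B t r / (light B * r) / 3) * w * d_w P2 t r w
  + 4 / 15 * compression B t r * P2 t r w.
Proof.
  intros H0 H1 H2 Hr Hw.
  (* [T] gathers the terms of D^+ free of the compression factor, which keep the power of mu; the
     terms with [K] keep it or raise it by two. *)
  set (T := fun P => (d_t P t r w + vel B t r * d_r P t r w) / light B
                     - vel B t r / (light B * r) * w * d_w P t r w).
  set (K := compression B t r).
  rewrite (mean_quartic _ t r w (T P0)
    (T P1 + K * P1 t r w)
    (T P2 + K * w * d_w P0 t r w + 2 * K * P2 t r w)
    (K * w * d_w P1 t r w - K * P1 t r w)
    (K * w * d_w P2 t r w - 2 * K * P2 t r w)).
  (* The inverses become indeterminates, so that [field] raises no side conditions about [light B]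
     or [r]. *)
  - unfold T, Rdiv; generalize (/ light B) (/ (light B * r)); intros; field.
  - intros mu Hmu; unfold D_plus.
    rewrite d_t_quad, d_r_quad, d_w_quad, d_mu_quad by assumption.
    unfold T, quad, F_mu_plus, F_w; fold K; unfold Rdiv; ring.
Qed.

(** By parity D^- contributes only through [P1]. Its two terms together are one third of the
    spherical divergence r^-2 d_r(r^2 P1), the source of the diffusion term. *)
Lemma mean_D_plus_D_minus_quad (B : background) (P0 P1 P2 : R -> R -> R -> R)
    (t r w : R) :
  partially_derivable P0 -> partially_derivable P1 -> partially_derivable P2 ->
  0 < r -> 0 < w ->
  mean (fun t r mu w => D_plus B (quad P0 P1 P2) t r mu w
                        + D_minus (quad P0 P1 P2) t r mu w) t r w =
  mean (D_plus B (quad P0 P1 P2)) t r w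
  + d_r P1 t r w / 3 + 2 / 3 * / r * P1 t r w.
Proof.
  intros H0 H1 H2 Hr Hw.
  set (T := fun P => (d_t P t r w + vel B t r * d_r P t r w) / light B
                     - vel B t r / (light B * r) * w * d_w P t r w).
  set (K := compression B t r).
  rewrite mean_D_plus_quad by assumption.
  rewrite (mean_quartic _ t r w (T P0 + / r * P1 t r w)
    (T P1 + K * P1 t r w + d_r P0 t r w + 2 * / r * P2 t r w)
    (T P2 + K * w * d_w P0 t r w + 2 * K * P2 t r w + d_r P1 t r w
     - / r * P1 t r w)
    (K * w * d_w P1 t r w - K * P1 t r w + d_r P2 t r w - 2 * / r * P2 t r w)
    (K * w * d_w P2 t r w - 2 * K * P2 t r w)).
  - unfold T, Rdiv; fold K.
    generalize (/ light B) (/ (light B * r)) (/ r); intros; field.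
  - intros mu Hmu; unfold D_plus, D_minus.
    rewrite d_t_quad, d_r_quad, d_w_quad, d_mu_quad by assumption.
    unfold T, quad, F_mu_plus, F_mu_minus, F_w; fold K; unfold Rdiv; ring.
Qed.

(** * Differentiability of the coefficients in D(beta) and f_1 *)

Lemma partially_derivable_vel (B : background) :
  background_ok B -> partially_derivable (fun t r _ => vel B t r).
Proof. intros HB; apply smooth_partially_derivable, (vel_smooth B HB). Qed.

(** The material derivative of ln rho is rewritten as that of rho divided by rho, a quotient of
    differentiable functions; this avoids second derivatives of the logarithm. *)
Lemma partially_derivable_dlnrho_dt (B : background) :
  background_ok B -> partially_derivable (fun t r _ => dlnrho_dt B t r).
Proof.
  intros HB.
  set (rho3 := fun t r (_ : R) => rho B t r).
  assert (Hrho : smooth rho3) by exact (rho_smooth B HB).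
  pose proof (smooth_partially_derivable _ Hrho) as Hrho'.
  apply (partially_derivable_eq3 (fun t r w =>
    (d_t rho3 t r w + vel B t r * d_r rho3 t r w) / rho3 t r w)).
  - intros t r w Hr Hw; unfold dlnrho_dt, Rdiv.
    pose proof (rho_pos B HB t r Hr) as Hpos.
    destruct (Hrho' t r w Hr Hw) as (Dt & Dr & _).
    unfold rho3 in Dt, Dr.
    assert (L : is_derive ln (rho B t r) (/ rho B t r))
      by now apply is_derive_ln.
    assert (L' : ex_derive ln (rho B t r)) by now exists (/ rho B t r).
    rewrite (Derive_comp ln (fun s => rho B s r)) by assumption.
    rewrite (Derive_comp ln (fun x => rho B t x)) by assumption.
    rewrite (is_derive_unique _ _ _ L).
    unfold d_t, d_r, rho3; ring.
  - apply partially_derivable_div.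
    + intros t r w Hr Hw; apply Rgt_not_eq, (rho_pos B HB t r Hr).
    + apply partially_derivable_plus; [| apply partially_derivable_mult].
      * now apply smooth_partially_derivable, smooth_d_t.
      * now apply partially_derivable_vel.
      * now apply smooth_partially_derivable, smooth_d_r.
    + exact Hrho'.
Qed.

(* The coefficients of 1 and of mu^2 in D(beta); that of mu is d_r beta. *)
Definition D_coef0 (B : background) (beta : R -> R -> R -> R) (t r w : R) : R :=
  (d_t beta t r w + vel B t r * d_r beta t r w) / light B
  + - (vel B t r / (light B * r) * (w * d_w beta t r w)).

Definition D_coef2 (B : background) (beta : R -> R -> R -> R) (t r w : R) : R :=
  compression B t r * (w * d_w beta t r w).

Lemma light_r_neq0 (B : background) (r : R) :
  background_ok B -> 0 < r -> light B * r <> 0.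
Proof.
  intros HB Hr; apply Rgt_not_eq, Rmult_lt_0_compat; [apply HB | exact Hr].
Qed.

Lemma partially_derivable_w_d_w (beta : R -> R -> R -> R) :
  smooth beta -> partially_derivable (fun t r w => w * d_w beta t r w).
Proof.
  intros Hbeta; apply partially_derivable_mult; [apply partially_derivable_w |].
  now apply smooth_partially_derivable, smooth_d_w.
Qed.

Lemma partially_derivable_D_coef0 (B : background) (beta : R -> R -> R -> R) :
  background_ok B -> smooth beta -> partially_derivable (D_coef0 B beta).
Proof.
  intros HB Hbeta; apply partially_derivable_plus.
  - apply partially_derivable_div.
    + intros; apply Rgt_not_eq, HB.
    + apply partially_derivable_plus; [| apply partially_derivable_mult].
      * now apply smooth_partially_derivable, smooth_d_t.
      * now apply partially_derivable_vel.
      * now apply smooth_partially_derivable, smooth_d_r.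
    + apply partially_derivable_const.
  - apply partially_derivable_opp, partially_derivable_mult.
    + apply partially_derivable_div.
      * intros; now apply light_r_neq0.
      * now apply partially_derivable_vel.
      * apply partially_derivable_mult;
          [apply partially_derivable_const | apply partially_derivable_r].
    + now apply partially_derivable_w_d_w.
Qed.

Lemma partially_derivable_D_coef2 (B : background) (beta : R -> R -> R -> R) :
  background_ok B -> smooth beta -> partially_derivable (D_coef2 B beta).
Proof.
  intros HB Hbeta; apply partially_derivable_mult;
    [| now apply partially_derivable_w_d_w].
  unfold compression; apply partially_derivable_plus;
    apply partially_derivable_div.
  - intros; apply Rgt_not_eq, HB.
  - now apply partially_derivable_dlnrho_dt.
  - apply partially_derivable_const.
  - intros; now apply light_r_neq0.
  - apply partially_derivable_mult;
      [apply partially_derivable_const | now apply partially_derivable_vel].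
  - apply partially_derivable_mult;
      [apply partially_derivable_const | apply partially_derivable_r].
Qed.

(** The factor of -f in [calJ], hence the divisor when an equation of the hierarchy is solved for
    f_i. *)
Definition extinction (M : medium) (t r w : R) : R :=
  chit M t r w + phi0 M t r w.

Lemma partially_derivable_extinction (M : medium) :
  medium_ok M -> partially_derivable (extinction M).
Proof.
  intros HM; apply partially_derivable_plus; [apply partially_derivable_plus |];
    apply smooth_partially_derivable, HM.
Qed.

Lemma partially_derivable_lambda (M : medium) :
  medium_ok M -> partially_derivable (lambda M).
Proof.
  intros HM; apply partially_derivable_div.
  - intros; now apply HM.
  - apply partially_derivable_const.
  - apply partially_derivable_plus; [now apply partially_derivable_extinction |].
    apply partially_derivable_opp, smooth_partially_derivable, HM.
Qed.


(** * Solving the hierarchy at orders zero and one *)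

Lemma along_0 (B : background) (M : medium)
    (F : nat -> R -> R -> R -> (nat -> R) -> R) (beta : R -> R -> R -> R) :
  medium_ok M -> hierarchy B M F beta -> strong_chapman_enskog F beta ->
  eq4 (along F beta 0) (fun t r _ w => beta t r w).
Proof.
  intros HM Hh Hs t r mu w Hr Hmu Hw.
  pose proof (chit_phi0_neq0 M HM t r w Hr Hw) as HS.
  pose proof (chit_phi0_phi1_neq0 M HM t r w Hr Hw) as Hl.
  pose proof (proj1 (Hs t r w Hr Hw)) as Hmean.
  set (f := along F beta 0) in *.
  set (m := mean_mu f t r w).
  set (S := chit M t r w + phi0 M t r w) in *.
  set (k := (emis M t r w + phi0 M t r w * beta t r w) / S).
  (* Besides its local value, [calJ] sees f_0 only through its mean, which is known, and its first
     moment [m], kept as an unknown. Solving for f_0 thus gives an affine function of mu. *)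
  assert (Hf : forall mu, -1 < mu < 1 ->
            f t r mu w = k + 3 * mu * (phi1 M t r w * m / S)).
  { intros mu' Hmu'.
    destruct (Hh t r mu' w Hr ltac:(lra) Hw) as [E _].
    fold f in E; unfold calJ, collision in E; fold m in E; rewrite Hmean in E.
    apply (Rmult_eq_reg_l S); [| exact HS].
    unfold k; field_simplify; [| exact HS]; unfold S; lra. }
  assert (Ek : beta t r w = k).
  { rewrite <- Hmean.
    rewrite (mean_quartic _ t r w k (3 * (phi1 M t r w * m / S)) 0 0 0);
      [field | intros mu' Hmu'; rewrite Hf by assumption; ring]; exact HS. }
  (* Only the left [m] is unfolded: the first moment of the affine form yields a linear equation for
     [m] itself. *)
  assert (Em : m = phi1 M t r w * m / S).
  { unfold m at 1, mean_mu.
    rewrite (mean_quartic _ t r w 0 k (3 * (phi1 M t r w * m / S)) 0 0);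
      [field | intros mu' Hmu'; rewrite Hf by assumption; ring]; exact HS. }
  (* The linear equation reads m (S - phi_1) = 0, and the second factor is the nonzero denominator
     of lambda. *)
  assert (m0 : m = 0).
  { apply (Rmult_eq_reg_r (S - phi1 M t r w)); [| exact Hl].
    apply (Rmult_eq_compat_r S) in Em.
    replace (phi1 M t r w * m / S * S) with (phi1 M t r w * m) in Em
      by (field; exact HS).
    lra. }
  rewrite Hf, Ek, m0 by assumption; field; exact HS.
Qed.

Lemma D_plus_isotropic (B : background) (beta : R -> R -> R -> R) :
  eq4 (D_plus B (fun t r _ w => beta t r w))
      (quad (D_coef0 B beta) (fun _ _ _ => 0) (D_coef2 B beta)).
Proof.
  intros t r mu w Hr Hmu Hw.
  unfold D_plus, quad, D_coef0, D_coef2, F_w, d_mu.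
  rewrite Derive_const; unfold freeze, Rdiv.
  change (fun t r w => beta t r w) with beta; ring.
Qed.

Lemma D_minus_isotropic (beta : R -> R -> R -> R) (t r mu w : R) :
  D_minus (fun t r _ w => beta t r w) t r mu w = mu * d_r beta t r w.
Proof.
  unfold D_minus, d_mu; rewrite Derive_const; unfold freeze.
  change (fun t r w => beta t r w) with beta; ring.
Qed.


Lemma D_order_0 (B : background) (M : medium)
    (F : nat -> R -> R -> R -> (nat -> R) -> R) (beta : R -> R -> R -> R) :
  medium_ok M -> smooth beta -> enskog_postulate F beta ->
  hierarchy B M F beta -> strong_chapman_enskog F beta ->
  eq4 (D_order B F beta 0) (quad (D_coef0 B beta) (d_r beta) (D_coef2 B beta)).
Proof.
  intros HM Hbeta Hpost Hh Hs t r mu w Hr Hmu Hw.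
  pose proof (along_0 B M F beta HM Hh Hs) as H0.
  rewrite D_order_along, (D_plus_eq4 B _ _ H0), (D_minus_eq4 _ _ H0),
    D_plus_isotropic, D_minus_isotropic by assumption.
  unfold quad; ring.
Qed.

(** The scheme of [along_0] with source D(beta). The zero mean of f_1 now acts as a solvability
    condition on D(beta), which is the first conclusion; the first moment determines the coefficient
    of mu. *)
Lemma along_1 (B : background) (M : medium)
    (F : nat -> R -> R -> R -> (nat -> R) -> R) (beta : R -> R -> R -> R) :
  medium_ok M -> smooth beta -> enskog_postulate F beta ->
  hierarchy B M F beta -> strong_chapman_enskog F beta ->
  eq3 (fun t r w => D_coef0 B beta t r w + D_coef2 B beta t r w / 3)
      (fun _ _ _ => 0) /\
  eq4 (along F beta 1)
      (quad (fun t r w => - D_coef0 B beta t r w / extinction M t r w)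
            (fun t r w => - (lambda M t r w * d_r beta t r w))
            (fun t r w => - D_coef2 B beta t r w / extinction M t r w)).
Proof.
  intros HM Hbeta Hpost Hh Hs.
  enough (H : forall t r w, 0 < r -> 0 < w ->
    D_coef0 B beta t r w + D_coef2 B beta t r w / 3 = 0 /\
    forall mu, -1 < mu < 1 -> along F beta 1 t r mu w =
      quad (fun t r w => - D_coef0 B beta t r w / extinction M t r w)
            (fun t r w => - (lambda M t r w * d_r beta t r w))
            (fun t r w => - D_coef2 B beta t r w / extinction M t r w) t r mu w).
  { split; [intros t r w Hr Hw | intros t r mu w Hr Hmu Hw];
      now apply (H t r w). }
  intros t r w Hr Hw.
  pose proof (chit_phi0_neq0 M HM t r w Hr Hw) as HS.
  pose proof (chit_phi0_phi1_neq0 M HM t r w Hr Hw) as Hl.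
  pose proof (proj2 (Hs t r w Hr Hw) 1%nat (le_n 1)) as Hmean.
  unfold quad, lambda, extinction.
  set (f := along F beta 1) in *.
  set (m := mean_mu f t r w).
  set (S := chit M t r w + phi0 M t r w) in *.
  set (a := D_coef0 B beta t r w).
  set (b := d_r beta t r w).
  set (e := D_coef2 B beta t r w).
  set (p := phi1 M t r w) in *.
  assert (Hf : forall mu, -1 < mu < 1 ->
            f t r mu w = - a / S + mu * ((3 * p * m - b) / S)
                         + mu ^ 2 * (- e / S)).
  { intros mu Hmu.
    destruct (Hh t r mu w Hr ltac:(lra) Hw) as [_ E].
    specialize (E 1%nat (le_n 1)); simpl Nat.sub in E.
    rewrite (D_order_0 B M F beta HM Hbeta Hpost Hh Hs) in E by assumption.
    unfold quad in E; fold a b e f in E.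
    unfold calJ, collision in E; fold m p in E; rewrite Hmean in E.
    apply (Rmult_eq_reg_l S); [| exact HS].
    field_simplify; [| exact HS]; unfold S; lra. }
  assert (Ea : a + e / 3 = 0).
  { rewrite (mean_quartic _ t r w (- a / S) ((3 * p * m - b) / S) (- e / S) 0 0)
      in Hmean by (intros mu Hmu; rewrite Hf by assumption; ring).
    replace (a + e / 3) with (- S * (- a / S + - e / S / 3 + 0 / 5))
      by (field; exact HS).
    rewrite Hmean; ring. }
  assert (Em : m * (S - p) = - b / 3).
  { assert (E : m = (3 * p * m - b) / S / 3).
    { unfold m at 1, mean_mu.
      rewrite (mean_quartic _ t r w 0 (- a / S) ((3 * p * m - b) / S)
                 (- e / S) 0);
        [field; exact HS | intros mu Hmu; rewrite Hf by assumption; ring]. }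
    apply (Rmult_eq_compat_r S) in E.
    replace ((3 * p * m - b) / S / 3 * S) with (p * m - b / 3) in E
      by (field; exact HS).
    lra. }
  split; [exact Ea |]; intros mu Hmu; rewrite Hf by assumption.
  (* With this value 3 p m - b equals -b S / (S - p), so [S] cancels and lambda appears. *)
  replace m with (- b / 3 / (S - p)) by (rewrite <- Em; field; exact Hl).
  field; split; assumption.
Qed.

(** * Matching the averaged equation at orders zero and one *)

Theorem theorem2p10 (B : background) (Mbar : medium)
    (F : nat -> R -> R -> R -> (nat -> R) -> R) (beta : R -> R -> R -> R)
    (HB : background_ok B) (HM : medium_ok Mbar) (Hbeta : smooth beta)
    (Hpostulate : enskog_postulate F beta)
    (Hhierarchy : hierarchy B Mbar F beta)
    (Hstrong : strong_chapman_enskog F beta)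
    (t r w : R) (Hr : 0 < r) (Hw : 0 < w) :
  exists g : nat -> R,
    has_expansion
      (fun eps => diffusion_lhs B (unbar eps Mbar) beta t r w
                  + neglected B (unbar eps Mbar) (along F beta 0) t r w) g /\
    O_eps 2 (fun i => mean (D_order B F beta i) t r w - g i).
Proof.
  (* The witness copies the averaged orders zero and one and then stops, so the order condition is
     immediate. The content is that the diffusion side plus the neglected term is exactly this
     polynomial of degree at most one in eps. *)
  exists (fun i => if Nat.ltb i 2 then mean (D_order B F beta i) t r w else 0).
  split.
  2:{ intros i Hi; rewrite (proj2 (Nat.ltb_lt i 2) Hi); ring. }
  exists 1%nat; split.
  { intros i Hi; now rewrite (proj2 (Nat.ltb_ge i 2) Hi). }
  intros eps Heps; simpl.
  pose proof (light_pos B HB) as Hc.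
  destruct (along_1 B Mbar F beta HM Hbeta Hpostulate Hhierarchy Hstrong)
    as [Hmean0 H1].
  set (P0 := fun t r w => - D_coef0 B beta t r w / extinction Mbar t r w) in H1.
  set (P1 := fun t r w => - (lambda Mbar t r w * d_r beta t r w)) in H1.
  set (P2 := fun t r w => - D_coef2 B beta t r w / extinction Mbar t r w) in H1.
  assert (d0 : partially_derivable P0).
  { apply partially_derivable_div.
    - exact (chit_phi0_neq0 Mbar HM).
    - now apply partially_derivable_opp, partially_derivable_D_coef0.
    - now apply partially_derivable_extinction. }
  assert (d1 : partially_derivable P1).
  { apply partially_derivable_opp, partially_derivable_mult.
    - now apply partially_derivable_lambda.
    - now apply smooth_partially_derivable, smooth_d_r. }
  assert (d2 : partially_derivable P2).
  { apply partially_derivable_div.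
    - exact (chit_phi0_neq0 Mbar HM).
    - now apply partially_derivable_opp, partially_derivable_D_coef2.
    - now apply partially_derivable_extinction. }
  pose proof (along_0 B Mbar F beta HM Hhierarchy Hstrong) as H0.
  (* In a + e/3 the term 3v/(cr) of the compression cancels -v/(cr), leaving only the density term
     in front of the omega derivative. *)
  assert (E0 : mean (D_order B F beta 0) t r w
    = (d_t beta t r w + vel B t r * d_r beta t r w) / light B
      + / 3 * (dlnrho_dt B t r / light B) * w * d_w beta t r w).
  { rewrite (mean_quartic _ t r w (D_coef0 B beta t r w) (d_r beta t r w)
      (D_coef2 B beta t r w) 0 0).
    - unfold D_coef0, D_coef2, compression; field.
      split; lra.
    - intros mu Hmu.
      rewrite (D_order_0 B Mbar F beta HM Hbeta Hpostulate Hhierarchy Hstrong)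
        by assumption.
      unfold quad; ring. }
  assert (E1 : mean (D_order B F beta 1) t r w
    = mean (D_plus B (quad P0 P1 P2)) t r w
      + d_r P1 t r w / 3 + 2 / 3 * / r * P1 t r w).
  { rewrite <- mean_D_plus_D_minus_quad by assumption.
    apply mean_eq4; [| assumption | assumption].
    intros s x mu y Hx Hmu Hy.
    now rewrite D_order_along, (D_plus_eq4 B _ _ H1), (D_minus_eq4 _ _ H1). }
  (* Both inner moments of D^+(f_0) vanish, the mean by solvability and the first moment by parity.
     Division by S/eps leaves eps times the even part of f_1. *)
  assert (EN : neglected B (unbar eps Mbar) (along F beta 0) t r w
    = eps * mean (D_plus B (quad P0 P1 P2)) t r w).
  { set (z := fun _ _ _ : R => 0).
    assert (HD : eq4 (D_plus B (along F beta 0))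
                   (quad (D_coef0 B beta) z (D_coef2 B beta))).
    { intros s x mu y Hx Hmu Hy.
      rewrite (D_plus_eq4 B _ _ H0) by assumption.
      now apply D_plus_isotropic. }
    assert (Hm : eq3 (mean (D_plus B (along F beta 0))) z).
    { intros s x y Hx Hy.
      rewrite (mean_quartic _ s x y (D_coef0 B beta s x y) 0
                 (D_coef2 B beta s x y) 0 0).
      - pose proof (Hmean0 s x y Hx Hy) as E; simpl in E; unfold z; lra.
      - intros mu Hmu; rewrite HD by assumption; unfold quad, z; ring. }
    assert (Hmm : eq3 (mean_mu (D_plus B (along F beta 0))) z).
    { intros s x y Hx Hy; unfold mean_mu.
      rewrite (mean_quartic _ s x y 0 (D_coef0 B beta s x y) 0
                 (D_coef2 B beta s x y) 0).
      - unfold z; field.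
      - intros mu Hmu; rewrite HD by assumption; unfold quad, z; ring. }
    unfold neglected.
    rewrite (mean_eq4 _ (D_plus B (quad (fun t r w => eps * P0 t r w) z
                                        (fun t r w => eps * P2 t r w)))).
    - assert (dscal : forall P, partially_derivable P ->
                partially_derivable (fun t r w => eps * P t r w)).
      { intros P dP; apply partially_derivable_mult;
          [apply partially_derivable_const | exact dP]. }
      (* The formula for the mean of D^+ does not contain the odd coefficient, so [z] and [P1] give
         the same value and eps factors out. *)
      unfold z; rewrite (mean_D_plus_quad B P0 P1 P2) by assumption.
      rewrite (mean_D_plus_quad B _ _ _ t r w (dscal _ d0)
                 (partially_derivable_const 0) (dscal _ d2)) by assumption.
      unfold d_t, d_r, d_w; rewrite !Derive_scal.
      change (fun y => P0 t r y) with (P0 t r).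
      change (fun y => P2 t r y) with (P2 t r).
      unfold Rdiv; ring.
    - apply D_plus_eq4; intros s x mu y Hx Hmu Hy.
      rewrite HD, Hm, Hmm by assumption.
      unfold quad, z, P0, P2, extinction, chit; simpl.
      pose proof (chit_phi0_neq0 Mbar HM s x y Hx Hy) as HS.
      pose proof (chit_neq0 Mbar HM s x y Hx Hy) as Hchi.
      unfold chit in HS, Hchi; field.
      repeat split; [exact HS | lra | exact Hchi].
    - assumption.
    - assumption. }
  (* Valid for every real [x], even where the denominator vanishes, because inversion is
     multiplicative with / 0 = 0. A global [Derive_ext] can therefore be used below. *)
  assert (EL : forall x, lambda (unbar eps Mbar) t x w = eps * lambda Mbar t x w).
  { intros x; unfold lambda, chit; simpl.
    replace (emis Mbar t x w / eps + absorp Mbar t x w / eps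
             + phi0 Mbar t x w / eps - phi1 Mbar t x w / eps)
      with ((emis Mbar t x w + absorp Mbar t x w
             + phi0 Mbar t x w - phi1 Mbar t x w) * / eps)
      by (field; lra).
    unfold Rdiv; rewrite Rinv_mult, Rinv_inv; ring. }
  (* The flux is -eps/3 times r^2 P1; the product rule, after division by r^2, gives the [P1] terms
     of [E1]. *)
  assert (ED : Derive (fun x => x ^ 2 * (lambda (unbar eps Mbar) t x w / 3)
                                * d_r beta t x w) r
    = - eps * (r ^ 2 * d_r P1 t r w / 3 + 2 / 3 * r * P1 t r w)).
  { rewrite (Derive_ext _ (fun x => (- eps / 3) * (x ^ 2 * P1 t x w))).
    2:{ intros x; rewrite EL; unfold P1; field. }
    destruct (d1 t r w Hr Hw) as (_ & Dr & _).
    rewrite Derive_scal, (Derive_mult (fun x => x ^ 2));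
      [| auto_derive; easy | exact Dr].
    assert (Hsq : Derive (fun x : R => x ^ 2) r = 2 * r)
      by (apply is_derive_unique; auto_derive; [easy | ring]).
    rewrite Hsq; unfold d_r; field. }
  rewrite EN, E0, E1; unfold diffusion_lhs; rewrite ED; field.
  split; lra.
Qed.
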